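(* Let $\Bbbk$ be an algebraically closed field with $\mathrm{char}(\Bbbk)\neq2$ and $A$ a finite dimensional unital associative $\mathbb{Z}_2$-graded $\Bbbk$-algebra. With $\mathrm{Id}$ the identity functor on $A\text{-smod}$, there is an isomorphism of superalgebras $$\mathrm{End}(\mathrm{Id})=\mathrm{SNat}(\mathrm{Id},\mathrm{Id})\;\cong\;s\mathcal{Z}(A).$$
   Context: The super centre $s\mathcal{Z}(A)$ is the subalgebra of $A$ spanned by homogeneous $x$ with $xy=(-1)^{\partial x\,\partial y}yx$ for all homogeneous $y\in A$. The supercategory $\mathcal{C}=A\text{-smod}$ has as objects the finite dimensional $\mathbb{Z}_2$-graded left $A$-modules. Its morphism spaces are $\mathbb{Z}_2$-graded: $\mathrm{Hom}_{\mathcal{C}}(M,N)_{\bar0}$ is the space of degree-preserving $A$-linear maps, and $\mathrm{Hom}_{\mathcal{C}}(M,N)_{\bar1}$ is the space of $f\in\mathrm{Hom}_\Bbbk(M_{\bar0},N_{\bar1})\oplus\mathrm{Hom}_\Bbbk(M_{\bar1},N_{\bar0})$ with $f(av)=(-1)^{\partial a}af(v)$ for homogeneous $a\in A$ and $v\in M$. For superfunctors $F,K$ on $\mathcal{C}$ (functors enriched over $\mathbb{Z}_2$-graded vector spaces), the supernatural transformations form a $\mathbb{Z}_2$-graded space $\mathrm{SNat}(F,K)=\mathrm{SNat}(F,K)_{\bar0}\oplus\mathrm{SNat}(F,K)_{\bar1}$: $\mathrm{SNat}(F,K)_{\bar0}$ consists of the natural transformations $\eta:F\Rightarrow K$ with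 every $\eta_M$ even; $\mathrm{SNat}(F,K)_{\bar1}$ consists of families of odd morphisms $\eta_M:F(M)\to K(M)$ with $\eta_N\circ F(f)=(-1)^{\partial f}K(f)\circ\eta_M$ for every homogeneous $f:M\to N$. The product on $\mathrm{SNat}(\mathrm{Id},\mathrm{Id})$ is composition. *)

(* Defs.v *)
From HB Require Import structures.
From mathcomp Require Import all_boot all_order all_algebra.
From mathcomp Require Import boolp.
Set Implicit Arguments.
Unset Strict Implicit.
Unset Printing Implicit Defensive.
Import GRing.Theory.
Local Open Scope ring_scope.

Section LinearProp.
Variables (k : fieldType) (U V : lmodType k) (f : U -> V).
Hypothesis lin_f : linear f.

Lemma linear_fun0 : f 0 = 0.
Proof. by have := lin_f (-1) 0 0; rewrite scaler0 addr0 scaleN1r addNr. Qed.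
Lemma linear_funD x y : f (x + y) = f x + f y.
Proof. by have := lin_f 1 x y; rewrite !scale1r. Qed.
Lemma linear_funZ c x : f (c *: x) = c *: f x.
Proof. by have := lin_f c x 0; rewrite linear_fun0 !addr0. Qed.
End LinearProp.

(* The group Z_2 is [bool] with [addb] (false is degree 0, true is degree 1); *)
(* [homog i x] means that x belongs to the homogeneous part of degree i, so   *)
(* that 0 is homogeneous of both degrees.                                     *)
HB.mixin Record isSuperSpace (k : fieldType) V of GRing.Lmodule k V := {
  homog : bool -> V -> Prop;
  homog0 : forall i, homog i 0;
  homogP : forall i (c : k) x y, homog i x -> homog i y -> homog i (c *: x + y);
  homog_dec : forall x, exists x0 x1,
    [/\ homog false x0, homog true x1 & x = x0 + x1];
  homog_disj : forall x, homog false x -> homog true x -> x = 0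
}.

#[short(type="superSpaceType")]
HB.structure Definition SuperSpace (k : fieldType) :=
  {V of isSuperSpace k V & GRing.Lmodule k V}.

#[short(type="finSuperSpaceType")]
HB.structure Definition FinSuperSpace (k : fieldType) :=
  {V of Vector k V & SuperSpace k V}.

(* The library's algType requires 1 != 0; the product is introduced here so   *)
(* that the zero algebra is not excluded.                                     *)
HB.mixin Record SuperSpace_isSuperAlgebra (k : fieldType) A
    of SuperSpace k A := {
  sone : A;
  smul : A -> A -> A;
  smulA : associative smul;
  smul1x : left_id sone smul;
  smulx1 : right_id sone smul;
  smul_linl : forall y : A, linear (fun x : A => smul x y);
  smul_linr : forall x : A, linear (smul x);
  homog_sone : homog false sone;
  homog_smul : forall i j (x y : A),
    homog i x -> homog j y -> homog (i (+) j) (smul x y)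
}.

#[short(type="superAlgType")]
HB.structure Definition SuperAlgebra (k : fieldType) :=
  {A of SuperSpace_isSuperAlgebra k A & SuperSpace k A}.

#[short(type="finSuperAlgType")]
HB.structure Definition FinSuperAlgebra (k : fieldType) :=
  {A of FinSuperSpace k A & SuperAlgebra k A}.

Notation "x *s y" := (smul x y)
  (at level 40, left associativity, format "x  *s  y") : ring_scope.

(* Superalgebras with carrier in a possibly larger universe: the supernatural *)
(* endotransformations of a functor range over all objects, and making them a *)
(* superAlgType would push all modules into a universe below that of k^o.     *)
Record largeSuperAlg (k : fieldType) := LargeSuperAlg {
  lcarrier :> Type;
  lzero : lcarrier;
  ladd : lcarrier -> lcarrier -> lcarrier;
  lscale : k -> lcarrier -> lcarrier;
  lone : lcarrier;
  lmul : lcarrier -> lcarrier -> lcarrier;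
  lhomog : bool -> lcarrier -> Prop;
  laddA : associative ladd;
  laddC : commutative ladd;
  ladd0 : left_id lzero ladd;
  laddN : forall x, ladd (lscale (-1) x) x = lzero;
  lscaleA : forall a b x, lscale a (lscale b x) = lscale (a * b) x;
  lscale1 : left_id 1 lscale;
  lscaleDr : forall a x y, lscale a (ladd x y) = ladd (lscale a x) (lscale a y);
  lscaleDl : forall a b x, lscale (a + b) x = ladd (lscale a x) (lscale b x);
  lmulA : associative lmul;
  lmul1x : left_id lone lmul;
  lmulx1 : right_id lone lmul;
  lmul_linl : forall c x x' y,
    lmul (ladd (lscale c x) x') y = ladd (lscale c (lmul x y)) (lmul x' y);
  lmul_linr : forall c x y y',
    lmul x (ladd (lscale c y) y') = ladd (lscale c (lmul x y)) (lmul x y');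
  lhomog0 : forall i, lhomog i lzero;
  lhomogP : forall i c x y,
    lhomog i x -> lhomog i y -> lhomog i (ladd (lscale c x) y);
  lhomog_dec : forall x, exists x0 x1,
    [/\ lhomog false x0, lhomog true x1 & x = ladd x0 x1];
  lhomog_disj : forall x, lhomog false x -> lhomog true x -> x = lzero;
  lhomog_one : lhomog false lone;
  lhomog_mul : forall i j x y,
    lhomog i x -> lhomog j y -> lhomog (i (+) j) (lmul x y)
}.

Definition largeSuperAlg_of (k : fieldType) (A : superAlgType k) :
    largeSuperAlg k :=
  @LargeSuperAlg k A 0 +%R *:%R sone smul homog
    (@addrA A) (@addrC A) (@add0r A)
    (fun x => etrans (congr1 (+%R^~ x) (scaleN1r x)) (addNr x))
    (@scalerA k A) (@scale1r k A) (@scalerDr k A)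
    (fun a b x => scalerDl x a b)
    smulA smul1x smulx1
    (fun c x x' y => smul_linl y c x x') (fun c x y y' => smul_linr x c y y')
    homog0 homogP homog_dec homog_disj homog_sone homog_smul.

(* The inverse of f is automatically a morphism of the same kind.             *)
Definition superAlgIso (k : fieldType) (A B : largeSuperAlg k) : Prop :=
  exists f : A -> B,
    [/\ bijective f /\ f (lone A) = lone B,
        forall x y, f (ladd x y) = ladd (f x) (f y),
        forall c x, f (lscale c x) = lscale c (f x),
        forall x y, f (lmul x y) = lmul (f x) (f y)
      & forall i x, lhomog i x -> lhomog i (f x)].

(* A pair of subspaces with trivial intersection in an ungraded space V, and  *)
(* their sum [dsum S] inside V, as a superspace.                              *)
Record gradedSub (k : fieldType) (V : lmodType k) := GradedSub {
  gpart :> bool -> V -> Prop;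
  gpart0 : forall i, gpart i 0;
  gpartP : forall i c x y, gpart i x -> gpart i y -> gpart i (c *: x + y);
  gpart_disj : forall x, gpart false x -> gpart true x -> x = 0
}.

Section DirectSum.
Variables (k : fieldType) (V : lmodType k) (S : gradedSub V).

Definition in_dsum (x : V) : Prop :=
  exists x0 x1, [/\ S false x0, S true x1 & x = x0 + x1].

(* Membership is turned into a boolean so that equality is equality in V.     *)
Definition in_dsumb : pred V := fun x => `[< in_dsum x >].

Record dsum : Type := DSum { dval : V; dvalP : in_dsumb dval }.

HB.instance Definition _ := [isSub for dval].
HB.instance Definition _ := [Choice of dsum by <:].

Lemma in_dsumD_closed c x y : in_dsum x -> in_dsum y -> in_dsum (c *: x + y).
Proof.
move=> [x0 [x1 [hx0 hx1 ->]]] [y0 [y1 [hy0 hy1 ->]]].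
exists (c *: x0 + y0), (c *: x1 + y1); split; try exact: gpartP.
by rewrite scalerDr addrACA.
Qed.

Lemma in_dsum_part i x : S i x -> in_dsum x.
Proof.
case: i => Sx.
  by exists 0, x; split; rewrite ?add0r //; exact: gpart0.
by exists x, 0; split; rewrite ?addr0 //; exact: gpart0.
Qed.

Fact in_dsumb_closed : submod_closed in_dsumb.
Proof.
split; first by apply/asboolP; apply: (@in_dsum_part false); exact: gpart0.
move=> c x y /asboolP hx /asboolP hy; apply/asboolP.
exact: in_dsumD_closed.
Qed.

HB.instance Definition _ :=
  GRing.SubChoice_isSubLmodule.Build k V in_dsumb dsum in_dsumb_closed.

Definition dsum_homog (i : bool) (x : dsum) : Prop := S i (dval x).

Definition mk_dsum x (h : in_dsum x) : dsum := DSum (asboolT h).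

Lemma dvalD (x y : dsum) : dval (x + y) = dval x + dval y.
Proof. exact: (raddfD (val : dsum -> V)). Qed.
Lemma dvalZ c (x : dsum) : dval (c *: x) = c *: dval x.
Proof. exact: (linearZZ (val : dsum -> V)). Qed.
Lemma dval0 : dval 0 = 0.
Proof. exact: (raddf0 (val : dsum -> V)). Qed.
Lemma dval_inj : injective dval. Proof. exact: val_inj. Qed.

Fact dsum_homog0 i : dsum_homog i 0.
Proof. by rewrite /dsum_homog dval0; exact: gpart0. Qed.
Fact dsum_homogP i (c : k) x y :
  dsum_homog i x -> dsum_homog i y -> dsum_homog i (c *: x + y).
Proof. by rewrite /dsum_homog dvalD dvalZ; exact: gpartP. Qed.
Fact dsum_homog_dec x : exists x0 x1,
  [/\ dsum_homog false x0, dsum_homog true x1 & x = x0 + x1].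
Proof.
have /asboolP[x0 [x1 [h0 h1 e]]] := dvalP x.
exists (mk_dsum (in_dsum_part h0)), (mk_dsum (in_dsum_part h1)); split=> //.
by apply: dval_inj; rewrite dvalD.
Qed.
Fact dsum_homog_disj x : dsum_homog false x -> dsum_homog true x -> x = 0.
Proof. by move=> h0 h1; apply: dval_inj; rewrite dval0; exact: (gpart_disj h0 h1). Qed.

HB.instance Definition _ := isSuperSpace.Build k dsum
  dsum_homog0 dsum_homogP dsum_homog_dec dsum_homog_disj.

End DirectSum.

Section DirectSumMul.
Variables (k : fieldType) (U V W : lmodType k) (m : U -> V -> W).
Variables (R : gradedSub U) (S : gradedSub V) (T : gradedSub W).
Hypothesis ml : forall v, linear (m^~ v).
Hypothesis mr : forall u, linear (m u).
Hypothesis mRST : forall i j u v, R i u -> S j v -> T (i (+) j) (m u v).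

Fact in_dsum_mul (x : dsum R) (y : dsum S) : in_dsum T (m (dval x) (dval y)).
Proof.
have /asboolP[x0 [x1 [hx0 hx1 ->]]] := dvalP x.
have /asboolP[y0 [y1 [hy0 hy1 ->]]] := dvalP y.
have mDl u u' v : m (u + u') v = m u v + m u' v := linear_funD (ml v) u u'.
have mDr u v v' : m u (v + v') = m u v + m u v' := linear_funD (mr u) v v'.
have TD i w w' : T i w -> T i w' -> T i (w + w').
  by move=> h h'; rewrite -[w]scale1r; exact: gpartP.
exists (m x0 y0 + m x1 y1), (m x0 y1 + m x1 y0); split.
- apply: TD; first exact: (mRST hx0 hy0); exact: (mRST hx1 hy1).
- apply: TD; first exact: (mRST hx0 hy1); exact: (mRST hx1 hy0).
by rewrite !mDl !mDr [m x1 y0 + _]addrC addrACA.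
Qed.

Definition dsum_mul (x : dsum R) (y : dsum S) : dsum T :=
  mk_dsum (in_dsum_mul x y).

Lemma dval_mul x y : dval (dsum_mul x y) = m (dval x) (dval y).
Proof. by []. Qed.

Fact dsum_mul_linl y : linear (dsum_mul^~ y).
Proof.
by move=> c x x'; apply: dval_inj; rewrite dvalD dvalZ !dval_mul dvalD dvalZ ml.
Qed.
Fact dsum_mul_linr x : linear (dsum_mul x).
Proof.
by move=> c y y'; apply: dval_inj; rewrite dvalD dvalZ !dval_mul dvalD dvalZ mr.
Qed.
Fact dsum_mul_homog i j x y :
  homog i x -> homog j y -> homog (i (+) j) (dsum_mul x y).
Proof. exact: mRST. Qed.
End DirectSumMul.

Section SuperCenter.
Variables (k : fieldType) (A : superAlgType k).

Definition supercentral (i : bool) (x : A) : Prop :=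
  homog i x /\
  forall j y, homog j y -> x *s y = (-1) ^+ (i && j) *: (y *s x).

Fact supercentral0 i : supercentral i 0.
Proof.
split=> [|j y _]; first exact: homog0.
by rewrite (linear_fun0 (smul_linl y)) (linear_fun0 (smul_linr y)) scaler0.
Qed.
Fact supercentralP i c x y :
  supercentral i x -> supercentral i y -> supercentral i (c *: x + y).
Proof.
move=> [hx cx] [hy cy]; split=> [|j z hz]; first exact: homogP.
by rewrite smul_linl smul_linr (cx _ _ hz) (cy _ _ hz) scalerDr !scalerA mulrC.
Qed.
Fact supercentral_disj x : supercentral false x -> supercentral true x -> x = 0.
Proof. by move=> [h0 _] [h1 _]; exact: homog_disj. Qed.

Definition supercentral_sub : gradedSub A :=
  GradedSub supercentral0 supercentralP supercentral_disj.

(* The sum of the spaces of even and of odd supercentral elements, which is   *)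
(* the span of the homogeneous supercentral elements: see superCenter_span.   *)
Definition superCenter : Type := dsum supercentral_sub.
HB.instance Definition _ := SuperSpace.on superCenter.

Lemma superCenter_span (x : A) :
  in_dsum supercentral_sub x <->
  exists s : seq (k * A),
    (forall p, p \in s -> exists i, supercentral i p.2) /\
    x = \sum_(p <- s) p.1 *: p.2.
Proof.
split=> [[x0 [x1 [h0 h1 ->]]]|[s [hs ->]]].
  exists [:: (1, x0); (1, x1)]; split=> [p|].
    by rewrite !inE => /orP[] /eqP->; [exists false | exists true].
  by rewrite !big_cons big_nil addr0 /= !scale1r.
elim: s hs => [|p s IH] hs; first rewrite big_nil.
  exact: (in_dsum_part (gpart0 supercentral_sub false)).
rewrite big_cons; have [i hi] := hs p (mem_head _ _).
apply: in_dsumD_closed; first exact: (@in_dsum_part _ _ supercentral_sub i).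
by apply: IH => q qs; apply: hs; rewrite inE qs orbT.
Qed.

Fact supercentral_sone : supercentral false sone.
Proof.
split=> [|j y _]; first exact: homog_sone.
by rewrite /= expr0 scale1r smul1x smulx1.
Qed.

Fact supercentral_smul i j x y :
  supercentral i x -> supercentral j y -> supercentral (i (+) j) (x *s y).
Proof.
move=> [hx cx] [hy cy]; split=> [|l z hz]; first exact: homog_smul.
rewrite -smulA (cy _ _ hz) (linear_funZ (smul_linr x)) smulA (cx _ _ hz).
rewrite (linear_funZ (smul_linl y)) scalerA -smulA.
congr (_ *: _); rewrite -signr_addb; congr ((-1) ^+ _).
by case: (i) (j) (l) => [] [] [].
Qed.

Definition superCenter_one : superCenter :=
  mk_dsum (in_dsum_part (supercentral_sone : supercentral_sub false sone)).
Definition superCenter_mul : superCenter -> superCenter -> superCenter :=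
  dsum_mul (@smul_linl k A) (@smul_linr k A)
    (supercentral_smul : forall i j x y, supercentral_sub i x ->
       supercentral_sub j y -> supercentral_sub (i (+) j) (x *s y)).

Fact superCenter_mulA : associative superCenter_mul.
Proof. by move=> x y z; apply: dval_inj; rewrite /= smulA. Qed.
Fact superCenter_mul1x : left_id superCenter_one superCenter_mul.
Proof. by move=> x; apply: dval_inj; rewrite /= smul1x. Qed.
Fact superCenter_mulx1 : right_id superCenter_one superCenter_mul.
Proof. by move=> x; apply: dval_inj; rewrite /= smulx1. Qed.

HB.instance Definition _ := SuperSpace_isSuperAlgebra.Build k superCenter
  superCenter_mulA superCenter_mul1x superCenter_mulx1
  (dsum_mul_linl _ _ _) (dsum_mul_linr _ _ _)
  supercentral_sone (dsum_mul_homog _ _ _).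
End SuperCenter.

(* Categories enriched over superspaces, and their enriched functors.         *)
Record superCategory (k : fieldType) := SuperCategory {
  sobj :> Type;
  shom : sobj -> sobj -> superSpaceType k;
  sid : forall M, shom M M;
  scomp : forall M N P, shom N P -> shom M N -> shom M P;
  scompA : forall M N P Q (h : shom P Q) (g : shom N P) (f : shom M N),
    scomp h (scomp g f) = scomp (scomp h g) f;
  scomp1f : forall M N (f : shom M N), scomp (sid N) f = f;
  scompf1 : forall M N (f : shom M N), scomp f (sid M) = f;
  scomp_linl : forall M N P (f : shom M N),
    linear (fun g : shom N P => scomp g f);
  scomp_linr : forall M N P (g : shom N P),
    linear (fun f : shom M N => scomp g f);
  homog_sid : forall M, homog false (sid M);
  homog_scomp : forall M N P i j (g : shom N P) (f : shom M N),
    homog i g -> homog j f -> homog (i (+) j) (scomp g f)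
}.

Record superFunctor (k : fieldType) (C D : superCategory k) := SuperFunctor {
  sfobj :> C -> D;
  sfmap : forall M N, shom M N -> shom (sfobj M) (sfobj N);
  sfmap_lin : forall M N, linear (@sfmap M N);
  sfmap_homog : forall M N i (f : shom M N), homog i f -> homog i (sfmap f);
  sfmap_id : forall M, sfmap (sid M) = sid (sfobj M);
  sfmap_comp : forall M N P (g : shom N P) (f : shom M N),
    sfmap (scomp g f) = scomp (sfmap g) (sfmap f)
}.

Definition idSuperFunctor (k : fieldType) (C : superCategory k) :
    superFunctor C C :=
  @SuperFunctor k C C (fun M => M) (fun M N f => f)
    (fun M N c f g => erefl) (fun M N i f h => h)
    (fun M => erefl) (fun M N P g f => erefl).

Section SNat.
Variables (k : fieldType) (C D : superCategory k) (F K : superFunctor C D).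

Definition family : Type := forall M : C, shom (F M) (K M).

Definition snat_even (e : family) : Prop :=
  (forall M, homog false (e M)) /\
  (forall M N (f : shom M N), scomp (e N) (sfmap F f) = scomp (sfmap K f) (e M)).

Definition snat_odd (e : family) : Prop :=
  (forall M, homog true (e M)) /\
  (forall M N j (f : shom M N), homog j f ->
     scomp (e N) (sfmap F f) = (-1) ^+ j *: scomp (sfmap K f) (e M)).

Definition snat_part (i : bool) := if i then snat_odd else snat_even.

Lemma snat_partE i e : snat_part i e <->
  (forall M, homog i (e M)) /\
  (forall M N j (f : shom M N), homog j f ->
     scomp (e N) (sfmap F f) = (-1) ^+ (i && j) *: scomp (sfmap K f) (e M)).
Proof.
case: i => //=; split=> [] [h n]; split=> // M N.
  by move=> j f _; rewrite expr0 scale1r.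
move=> f; have [f0 [f1 [h0 h1 ->]]] := homog_dec f.
have sD (G : superFunctor C D) := linear_funD (@sfmap_lin _ _ _ G M N) f0 f1.
rewrite !sD (linear_funD (scomp_linr (e N))) (linear_funD (scomp_linl (e M))).
by rewrite (n _ _ _ _ h0) (n _ _ _ _ h1) expr0 !scale1r.
Qed.

Definition family_zero : family := fun=> 0.
Definition family_add (e h : family) : family := fun M => e M + h M.
Definition family_scale (c : k) (e : family) : family := fun M => c *: e M.

Definition in_snat (e : family) : Prop :=
  exists e0 e1, [/\ snat_even e0, snat_odd e1 & e = family_add e0 e1].

Lemma familyP (e h : family) : (forall M, e M = h M) -> e = h.
Proof. exact: functional_extensionality_dep. Qed.

Fact snat_part0 i : snat_part i family_zero.
Proof.
apply/snat_partE; split=> [M|M N j f _]; first exact: homog0.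
by rewrite /family_zero (linear_fun0 (scomp_linl _)) (linear_fun0 (scomp_linr _))
  scaler0.
Qed.
Fact snat_partP i c e h : snat_part i e -> snat_part i h ->
  snat_part i (family_add (family_scale c e) h).
Proof.
move=> /snat_partE[he ne] /snat_partE[hh nh]; apply/snat_partE.
split=> [M|M N j f hf]; first exact: homogP.
by rewrite /family_add /family_scale scomp_linl scomp_linr (ne _ _ _ _ hf)
  (nh _ _ _ _ hf) scalerDr !scalerA mulrC.
Qed.
Fact snat_partD i e h :
  snat_part i e -> snat_part i h -> snat_part i (family_add e h).
Proof.
move=> he hh; have := snat_partP 1 he hh; congr snat_part.
by apply: familyP => M; rewrite /family_add /family_scale scale1r.
Qed.
Fact snat_part_disj e :
  snat_part false e -> snat_part true e -> e = family_zero.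
Proof. by move=> [h0 _] [h1 _]; apply: familyP => M; exact: homog_disj. Qed.

Lemma in_snat_part i e : snat_part i e -> in_snat e.
Proof.
case: i => he.
  exists family_zero, e; split=> //; first exact: (snat_part0 false).
  by apply: familyP => M; rewrite /family_add add0r.
exists e, family_zero; split=> //; first exact: (snat_part0 true).
by apply: familyP => M; rewrite /family_add addr0.
Qed.

Fact in_snatP c e h :
  in_snat e -> in_snat h -> in_snat (family_add (family_scale c e) h).
Proof.
move=> [e0 [e1 [he0 he1 ->]]] [h0 [h1 [hh0 hh1 ->]]].
exists (family_add (family_scale c e0) h0), (family_add (family_scale c e1) h1).
split; [exact: (@snat_partP false) | exact: (@snat_partP true) |].
by apply: familyP => M; rewrite /family_add /family_scale scalerDr addrACA.
Qed.
Fact in_snatD e h : in_snat e -> in_snat h -> in_snat (family_add e h).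
Proof.
move=> he hh; have := in_snatP 1 he hh; congr in_snat.
by apply: familyP => M; rewrite /family_add /family_scale scale1r.
Qed.
Fact in_snatZ c e : in_snat e -> in_snat (family_scale c e).
Proof.
move=> he; have := in_snatP c he (in_snat_part (snat_part0 false)).
congr in_snat.
by apply: familyP => M; rewrite /family_add /family_scale addr0.
Qed.

Record snat : Type := SNat { snat_fam :> family; snatP : in_snat snat_fam }.

Lemma snat_inj (e h : snat) : (forall M, snat_fam e M = snat_fam h M) -> e = h.
Proof.
case: e h => [e he] [h hh] /= eh; move: he hh; rewrite (familyP eh) => he hh.
by congr SNat; exact: Prop_irrelevance.
Qed.

Definition snat_zero : snat := SNat (in_snat_part (snat_part0 false)).
Definition snat_add (e h : snat) : snat := SNat (in_snatD (snatP e) (snatP h)).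
Definition snat_scale c (e : snat) : snat := SNat (in_snatZ c (snatP e)).
Definition snat_homog (i : bool) (e : snat) : Prop := snat_part i e.

Fact snat_homog_dec e : exists e0 e1,
  [/\ snat_homog false e0, snat_homog true e1 & e = snat_add e0 e1].
Proof.
have [e0 [e1 [h0 h1 eq]]] := snatP e.
exists (SNat (@in_snat_part false _ h0)), (SNat (@in_snat_part true _ h1)).
by split=> //; apply: snat_inj => M; rewrite eq.
Qed.
End SNat.

Section SNatEnd.
Variables (k : fieldType) (C D : superCategory k) (F : superFunctor C D).

Definition family_one : family F F := fun M => sid (F M).
Definition family_comp (e h : family F F) : family F F :=
  fun M => scomp (e M) (h M).

Fact snat_part_one : snat_part false family_one.
Proof.
by split=> [M|M N f]; [exact: homog_sid | rewrite /family_one scomp1f scompf1].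
Qed.

Fact snat_part_comp i j e h :
  snat_part i e -> snat_part j h -> snat_part (i (+) j) (family_comp e h).
Proof.
move=> /snat_partE[he ne] /snat_partE[hh nh]; apply/snat_partE.
split=> [M|M N l f hf]; first exact: homog_scomp.
rewrite /family_comp.
rewrite -scompA (nh _ _ _ _ hf) (linear_funZ (scomp_linr _)) scompA.
rewrite (ne _ _ _ _ hf) (linear_funZ (scomp_linl _)) scalerA scompA -signr_addb.
by congr ((-1) ^+ _ *: _); case: (i) (j) (l) => [] [] [].
Qed.

Fact in_snat_comp e h : in_snat e -> in_snat h -> in_snat (family_comp e h).
Proof.
move=> [e0 [e1 [he0 he1 ->]]] [h0 [h1 [hh0 hh1 ->]]].
exists (family_add (family_comp e0 h0) (family_comp e1 h1)).
exists (family_add (family_comp e0 h1) (family_comp e1 h0)); split.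
- exact: (@snat_partD _ _ _ _ _ false _ _
    (@snat_part_comp false false _ _ he0 hh0)
    (@snat_part_comp true true _ _ he1 hh1)).
- exact: (@snat_partD _ _ _ _ _ true _ _
    (@snat_part_comp false true _ _ he0 hh1)
    (@snat_part_comp true false _ _ he1 hh0)).
apply: familyP => M; rewrite /family_comp /family_add.
rewrite (linear_funD (scomp_linl _)) !(linear_funD (scomp_linr _)).
by rewrite [scomp (e1 M) (h0 M) + _]addrC addrACA.
Qed.

Definition snat_one : snat F F := SNat (in_snat_part snat_part_one).
Definition snat_comp (e h : snat F F) : snat F F :=
  SNat (in_snat_comp (snatP e) (snatP h)).

Definition snatEnd : largeSuperAlg k.
Proof.
refine (@LargeSuperAlg k (snat F F) (snat_zero F F) (@snat_add _ _ _ F F)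
  (@snat_scale _ _ _ F F) snat_one snat_comp (@snat_homog _ _ _ F F)
  _ _ _ _ _ _ _ _ _ _ _ _ _ _ _ _ _ _ _).
- by move=> x y z; apply: snat_inj => M; exact: addrA.
- by move=> x y; apply: snat_inj => M; exact: addrC.
- by move=> x; apply: snat_inj => M; exact: add0r.
- move=> x; apply: snat_inj => M; rewrite /= /family_add /family_scale.
  by rewrite scaleN1r addNr.
- by move=> a b x; apply: snat_inj => M; exact: scalerA.
- by move=> x; apply: snat_inj => M; exact: scale1r.
- by move=> a x y; apply: snat_inj => M; exact: scalerDr.
- by move=> a b x; apply: snat_inj => M; exact: scalerDl.
- by move=> x y z; apply: snat_inj => M; exact: scompA.
- by move=> x; apply: snat_inj => M; exact: scomp1f.
- by move=> x; apply: snat_inj => M; exact: scompf1.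
- by move=> c x x' y; apply: snat_inj => M; exact: scomp_linl.
- by move=> c x y y'; apply: snat_inj => M; exact: scomp_linr.
- exact: snat_part0.
- by move=> i c x y; exact: snat_partP.
- exact: snat_homog_dec.
- by move=> x h0 h1; apply: snat_inj => M; rewrite (snat_part_disj h0 h1).
- exact: snat_part_one.
- by move=> i j x y; exact: snat_part_comp.
Defined.
End SNatEnd.

Section SMod.
Variables (k : fieldType) (A : superAlgType k).

Record smod := SMod {
  smod_space :> finSuperSpaceType k;
  sact : A -> smod_space -> smod_space;
  sact_linl : forall v, linear (sact^~ v);
  sact_linr : forall a, linear (sact a);
  sact1 : forall v, sact sone v = v;
  sactM : forall a b v, sact (a *s b) v = sact a (sact b v);
  sact_homog : forall i j a v,
    homog i a -> homog j v -> homog (i (+) j) (sact a v)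
}.

Section SModHom.
Variables M N : smod.

Definition smod_hom_even (f : 'Hom(M, N)) : Prop :=
  (forall j v, homog j v -> homog j (f v)) /\
  (forall a v, f (sact a v) = sact a (f v)).

Definition smod_hom_odd (f : 'Hom(M, N)) : Prop :=
  (forall j v, homog j v -> homog (~~ j) (f v)) /\
  (forall i j a v, homog i a -> homog j v ->
     f (sact a v) = (-1) ^+ i *: sact a (f v)).

Definition smod_hom_part (d : bool) := if d then smod_hom_odd else smod_hom_even.

Lemma smod_hom_partE d f : smod_hom_part d f <->
  (forall j v, homog j v -> homog (d (+) j) (f v)) /\
  (forall i a v, homog i a -> f (sact a v) = (-1) ^+ (d && i) *: sact a (f v)).
Proof.
have actD (P : smod) a (u v : P) := linear_funD (@sact_linr P a) u v.
case: d => /=; split=> [] [h n]; split=> //.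
- move=> i a v ha; have [v0 [v1 [h0 h1 ->]]] := homog_dec v.
  by rewrite actD !raddfD /= actD (n _ _ _ _ ha h0) (n _ _ _ _ ha h1) scalerDr.
- by move=> i j a v ha _; exact: n.
- by move=> i a v _; rewrite expr0 scale1r.
move=> a v; have [a0 [a1 [h0 h1 ->]]] := homog_dec a.
have actDl (P : smod) (u : P) := linear_funD (sact_linl u) a0 a1.
by rewrite !actDl raddfD /= (n _ _ _ h0) (n _ _ _ h1) expr0 !scale1r.
Qed.

Fact smod_hom_part0 d : smod_hom_part d 0.
Proof.
apply/smod_hom_partE; split=> [j v _|i a v _]; rewrite !lfunE /=.
  exact: homog0.
by rewrite (linear_fun0 (@sact_linr N a)) scaler0.
Qed.
Fact smod_hom_partP d c f g :
  smod_hom_part d f -> smod_hom_part d g -> smod_hom_part d (c *: f + g).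
Proof.
move=> /smod_hom_partE[hf nf] /smod_hom_partE[hg ng]; apply/smod_hom_partE.
have E u : (c *: f + g) u = c *: f u + g u by rewrite !lfunE /= lfunE.
split=> [j v hv|i a v ha]; rewrite !E.
  by apply: homogP; [exact: hf | exact: hg].
by rewrite (nf _ _ _ ha) (ng _ _ _ ha) sact_linr scalerDr !scalerA mulrC.
Qed.
Fact smod_hom_part_disj f : smod_hom_part false f -> smod_hom_part true f -> f = 0.
Proof.
move=> [h0 _] [h1 _]; apply/lfunP => v; rewrite lfunE /=.
have [v0 [v1 [e0 e1 ->]]] := homog_dec v; rewrite raddfD /=.
have -> : f v0 = 0 by apply: homog_disj; [exact: h0 | exact: (h1 false)].
have -> : f v1 = 0 by apply: homog_disj; [exact: (h1 true) | exact: h0].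
by rewrite addr0.
Qed.

Definition smod_hom_sub : gradedSub 'Hom(M, N) :=
  GradedSub smod_hom_part0 smod_hom_partP smod_hom_part_disj.

Definition smodHom : superSpaceType k := dsum smod_hom_sub.
End SModHom.

Fact smod_id_even M : smod_hom_sub M M false \1%VF.
Proof. by split=> [j v|a v]; rewrite !lfunE. Qed.

Fact smod_comp_homog (M N P : smod) i j (g : 'Hom(N, P)) (f : 'Hom(M, N)) :
  smod_hom_sub N P i g -> smod_hom_sub M N j f ->
  smod_hom_sub M P (i (+) j) (g \o f)%VF.
Proof.
move=> /smod_hom_partE[hg ng] /smod_hom_partE[hf nf]; apply/smod_hom_partE.
split=> [l v hv|l a v ha]; rewrite !lfunE /=.
  by rewrite -addbA; apply: hg; apply: hf.
rewrite (nf _ _ _ ha) linearZ /= (ng _ _ _ ha) scalerA -signr_addb.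
by congr ((-1) ^+ _ *: _); case: (i) (j) (l) => [] [] [].
Qed.

Fact lfun_comp_linl (M N P : smod) (f : 'Hom(M, N)) :
  linear (fun g : 'Hom(N, P) => (g \o f)%VF).
Proof. by move=> c g g'; rewrite comp_lfunDl comp_lfunZl. Qed.
Fact lfun_comp_linr (M N P : smod) (g : 'Hom(N, P)) :
  linear (fun f : 'Hom(M, N) => (g \o f)%VF).
Proof. by move=> c f f'; rewrite comp_lfunDr comp_lfunZr. Qed.

Definition smod_id M : smodHom M M := mk_dsum (in_dsum_part (smod_id_even M)).
Definition smod_comp M N P : smodHom N P -> smodHom M N -> smodHom M P :=
  dsum_mul (@lfun_comp_linl M N P) (@lfun_comp_linr M N P)
    (@smod_comp_homog M N P).

Fact smod_compA M N P Q (h : smodHom P Q) (g : smodHom N P) (f : smodHom M N) :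
  smod_comp h (smod_comp g f) = smod_comp (smod_comp h g) f.
Proof. by apply: dval_inj; rewrite /= comp_lfunA. Qed.
Fact smod_comp1f M N (f : smodHom M N) : smod_comp (smod_id N) f = f.
Proof. by apply: dval_inj; rewrite /= comp_lfun1l. Qed.
Fact smod_compf1 M N (f : smodHom M N) : smod_comp f (smod_id M) = f.
Proof. by apply: dval_inj; rewrite /= comp_lfun1r. Qed.

Definition smodCategory : superCategory k :=
  @SuperCategory k smod smodHom smod_id smod_comp
    smod_compA smod_comp1f smod_compf1
    (fun M N P => dsum_mul_linl _ _ _) (fun M N P => dsum_mul_linr _ _ _)
    smod_id_even (fun M N P => dsum_mul_homog _ _ _).
End SMod.

(* Main.v *)
Require Import Defs.
From HB Require Import structures.
From mathcomp Require Import all_boot all_order all_algebra.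
From mathcomp Require Import boolp.
Set Implicit Arguments.
Unset Strict Implicit.
Unset Printing Implicit Defensive.
Import GRing.Theory.
Local Open Scope ring_scope.

(** For v of degree j in a module M, the map x |-> (-1)^(j |x|) x v is a
    morphism of degree j from the regular module A to M sending 1 to v.
    Supernaturality of a transformation e with respect to it yields
    e_M v = z v, where z = e_A 1; the two signs, from the naturality square and
    from the parity of z, cancel.  Since e_M is moreover A-superlinear, the case
    M = A shows that z is supercentral.  Conversely, a supercentral element acts
    on every module by a supernatural transformation. *)

Section Parity.
Variables (k : fieldType) (V : superSpaceType k).

Lemma homogZ i (c : k) (x : V) : homog i x -> homog i (c *: x).
Proof. by move=> hx; rewrite -[_ *: x]addr0; apply/homogP/homog0. Qed.

(** The difference x0 - y0 = y1 - x1 is both even and odd, hence zero. *)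
Lemma homog_dec_unique (x0 x1 y0 y1 : V) :
  homog false x0 -> homog true x1 -> homog false y0 -> homog true y1 ->
  x0 + x1 = y0 + y1 -> x0 = y0 /\ x1 = y1.
Proof.
move=> hx0 hx1 hy0 hy1 e.
have d : x0 - y0 = y1 - x1.
  by apply/eqP; rewrite subr_eq addrAC eq_sym subr_eq e addrC.
have d0 : x0 - y0 = 0.
  apply: homog_disj; [|rewrite d]; rewrite -scaleN1r addrC; exact: homogP.
split; apply/eqP; first by rewrite -subr_eq0 d0.
by rewrite eq_sym -subr_eq0 -d d0.
Qed.

(** Decompositions are only asserted to exist, so choice selects one for each vector. Their
    uniqueness makes [s] independent of the selection, and linearity follows. *)
Lemma parity_exists : exists s : V -> V,
  linear s /\ forall i x, homog i x -> s x = (-1) ^+ i *: x.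
Proof.
pose P (x : V) (y : V) := exists x0 x1,
  [/\ homog false x0, homog true x1, x = x0 + x1 & y = x0 - x1].
have /choice[s sP] x : exists y, P x y.
  have [x0 [x1 [h0 h1 ->]]] := homog_dec x.
  by exists (x0 - x1), x0, x1.
have sE x0 x1 : homog false x0 -> homog true x1 -> s (x0 + x1) = x0 - x1.
  move=> h0 h1; have [y0 [y1 [g0 g1 e ->]]] := sP (x0 + x1).
  by have [-> ->] := homog_dec_unique h0 h1 g0 g1 e.
exists s; split=> [c x y|[] x hx].
- have [x0 [x1 [hx0 hx1 ->]]] := homog_dec x.
  have [y0 [y1 [hy0 hy1 ->]]] := homog_dec y.
  rewrite scalerDr addrACA !sE //; try exact: homogP.
  by rewrite scalerBr opprD addrACA.
- by rewrite -[x in LHS]add0r sE //; [rewrite sub0r scaleN1r | exact: homog0].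
by rewrite -[x in LHS]addr0 sE //; [rewrite subr0 scale1r | exact: homog0].
Qed.
End Parity.

Section RegularModule.
Variables (k : fieldType) (A : finSuperAlgType k).

(** Finite dimensionality of A makes the regular module an object of the category. *)
Definition regular_smod : smod A :=
  @SMod k A A smul (@smul_linl k A) (@smul_linr k A) smul1x
    (fun a b v => esym (smulA a b v)) homog_smul.

Lemma regular_smod_hom (M : smod A) j (v : M) : homog j v ->
  exists r : smodHom regular_smod M, homog j r /\
    forall i x, homog i x -> dval r x = (-1) ^+ (i && j) *: sact x v.
Proof.
move=> hv; have [s [s_lin sE]] := parity_exists A.
(* The parity involution [s] extends the sign (-1)^(j |x|) linearly to inhomogeneous x. *)
pose t (x : regular_smod) : M := sact (if j then s x else x) v.
have t_lin : linear t.
  by move=> c x y; rewrite /t; case: (j); rewrite ?s_lin sact_linl.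
have tE i x : homog i x -> t x = (-1) ^+ (i && j) *: sact x v.
  rewrite /t; case: (j) => hx; last by rewrite andbF scale1r.
  by rewrite (sE _ _ hx) (linear_funZ (sact_linl v)) andbT.
pose tL : {linear regular_smod -> M} := HB.pack t (GRing.isLinear.Build _ _ _ _ t t_lin).
have rE x : linfun tL x = t x by rewrite lfunE.
have hr : smod_hom_sub regular_smod M j (linfun tL).
  apply/smod_hom_partE; split=> [i x hx|i a x ha].
    by rewrite rE (tE _ _ hx) addbC; apply/homogZ/sact_homog.
  have [x0 [x1 [h0 h1 ->]]] := homog_dec x.
  rewrite !rE /= (linear_funD (smul_linr a)) !(linear_funD t_lin).
  rewrite (tE _ _ (homog_smul _ _ _ _ ha h0)) (tE _ _ (homog_smul _ _ _ _ ha h1)).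
  rewrite (tE _ _ h0) (tE _ _ h1) (linear_funD (@sact_linr _ _ _ a)).
  rewrite !(linear_funZ (@sact_linr _ _ _ a)) !sactM scalerDr !scalerA.
  rewrite -!signr_addb.
  (* On the part of x of degree l, the signs agree because (i + l) j = j i + l j modulo 2. *)
  by congr (_ ^+ _ *: _ + _ ^+ _ *: _); case: (i) (j) => [] [].
exists (mk_dsum (in_dsum_part hr)); split=> // i x hx.
by rewrite /= rE (tE _ _ hx).
Qed.
End RegularModule.

Section CenterAction.
Variables (k : fieldType) (A : finSuperAlgType k).
Local Notation idF := (idSuperFunctor (smodCategory A)).

Definition act_lfun (M : smod A) (x : A) : 'Hom(M, M) :=
  linfun (HB.pack (sact x : M -> M)
    (GRing.isLinear.Build _ _ _ _ (sact x : M -> M) (@sact_linr _ _ M x))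
    : {linear M -> M}).

Lemma act_lfunE (M : smod A) x (v : M) : act_lfun M x v = sact x v.
Proof. by rewrite lfunE. Qed.

(** Moving x past a in x(av) = (xa)v produces exactly the sign required of a morphism of degree
    i. *)
Lemma act_lfun_homog (M : smod A) i x : supercentral i x ->
  smod_hom_sub M M i (act_lfun M x).
Proof.
move=> [hx cx]; apply/smod_hom_partE; split=> [j v hv|j a v ha].
  by rewrite act_lfunE; exact: sact_homog.
by rewrite !act_lfunE -!sactM (cx _ _ ha) (linear_funZ (sact_linl v)).
Qed.

Lemma in_dsum_act (z : superCenter A) (M : smod A) :
  in_dsum (smod_hom_sub M M) (act_lfun M (dval z)).
Proof.
have /asboolP[x0 [x1 [h0 h1 ->]]] := dvalP z.
exists (act_lfun M x0), (act_lfun M x1); split; try exact: act_lfun_homog.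
apply/lfunP => v; rewrite add_lfunE !act_lfunE.
exact: (linear_funD (sact_linl v)).
Qed.

Definition act_family (z : superCenter A) : Defs.family idF idF :=
  fun M => mk_dsum (in_dsum_act z M).

Lemma dval_act_family z (M : smod A) (v : M) :
  dval (act_family z M) v = sact (dval z) v.
Proof. exact: act_lfunE. Qed.

(** Supernaturality with respect to f is the superlinearity of f for the scalar z; the two signs
    (-1)^(ij) cancel. *)
Lemma act_family_homog i (z : superCenter A) : homog i z ->
  snat_part i (act_family z).
Proof.
move=> hz; apply/snat_partE; split=> [M|M N j f hf].
  exact: act_lfun_homog.
apply: dval_inj; rewrite dvalZ /=; apply/lfunP => v.
rewrite scale_lfunE !comp_lfunE !act_lfunE.
have /smod_hom_partE[_ nf] := hf.
by rewrite (nf i _ _ (proj1 hz)) scalerA -signr_addb andbC addbb scale1r.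
Qed.

Lemma act_familyD y z :
  act_family (y + z) = family_add (act_family y) (act_family z).
Proof.
apply: Defs.familyP => M; apply: dval_inj; apply/lfunP => v.
rewrite dvalD add_lfunE !dval_act_family dvalD.
exact: (linear_funD (sact_linl v)).
Qed.

Lemma in_snat_act z : in_snat (act_family z).
Proof.
have [z0 [z1 [h0 h1 ->]]] := homog_dec z; rewrite act_familyD.
apply: in_snatD; first exact: (in_snat_part (act_family_homog h0)).
exact: (in_snat_part (act_family_homog h1)).
Qed.

Definition act_snat (z : superCenter A) : snat idF idF := SNat (in_snat_act z).
End CenterAction.

Section Evaluation.
Variables (k : fieldType) (A : finSuperAlgType k).
Local Notation idF := (idSuperFunctor (smodCategory A)).
Local Notation regA := (regular_smod A).

Definition eval_one (e : Defs.family idF idF) : A := dval (e regA) sone.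

(** A Yoneda argument: each homogeneous w in M is the image of [sone] under a homogeneous morphism
    from the regular module, so the component there determines all others. *)
Lemma snat_part_act i (e : Defs.family idF idF) (M : smod A) (v : M) :
  snat_part i e -> dval (e M) v = sact (eval_one e) v.
Proof.
move=> /snat_partE[he ne].
suff H j (w : M) : homog j w -> dval (e M) w = sact (eval_one e) w.
  have [v0 [v1 [h0 h1 ->]]] := homog_dec v.
  rewrite raddfD /= (H _ _ h0) (H _ _ h1).
  by rewrite (linear_funD (@sact_linr _ _ _ _)).
move=> hw; have [r [hr rE]] := regular_smod_hom hw.
have r1 : dval r sone = w by rewrite (rE _ _ (homog_sone)) scale1r sact1.
have h1 : homog i (eval_one e).
  have /smod_hom_partE[h _] := he regA.
  by rewrite -[i]addbF; exact: (h _ _ (homog_sone)).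
(* With z = [eval_one e], the square for [r] at [sone] reads e_M w = (-1)^(ij) r(z), and r(z) =
   (-1)^(ij) z w since z has degree i. *)
have /(congr1 (fun f : smodHom regA M => dval f sone)) := ne _ _ _ _ hr.
rewrite dvalZ scale_lfunE /= !comp_lfunE r1 => ->.
by rewrite (rE _ _ h1) scalerA -signr_addb addbb scale1r.
Qed.

Lemma in_snat_act_eval (e : Defs.family idF idF) (M : smod A) (v : M) :
  in_snat e -> dval (e M) v = sact (eval_one e) v.
Proof.
move=> [e0 [e1 [h0 h1 ->]]]; rewrite /eval_one /family_add !dvalD !add_lfunE.
rewrite (@snat_part_act false _ _ _ h0) (@snat_part_act true _ _ _ h1).
by rewrite (linear_funD (sact_linl v)).
Qed.

(** The value of e_A at y = y 1 is computed twice: it is z y by [snat_part_act], and y z up to the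
    sign by superlinearity of e_A. *)
Lemma eval_one_supercentral i (e : Defs.family idF idF) :
  snat_part i e -> supercentral i (eval_one e).
Proof.
move=> he; have /snat_partE[h _] := he.
have /smod_hom_partE[h1 l1] := h regA; split.
  by rewrite -[i]addbF; exact: (h1 _ _ (homog_sone)).
move=> j y hy; have := l1 _ _ sone hy.
by rewrite (@snat_part_act i _ regA _ he) /= smulx1.
Qed.

Lemma in_dsum_eval_one (e : Defs.family idF idF) :
  in_snat e -> in_dsum (supercentral_sub A) (eval_one e).
Proof.
move=> [e0 [e1 [h0 h1 ->]]]; exists (eval_one e0), (eval_one e1); split.
- exact: (@eval_one_supercentral false).
- exact: (@eval_one_supercentral true).
by rewrite /eval_one /family_add dvalD add_lfunE.
Qed.

Definition eval_snat (e : snat idF idF) : superCenter A :=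
  mk_dsum (in_dsum_eval_one (snatP e)).

Lemma eval_snatK : cancel eval_snat (@act_snat k A).
Proof.
move=> e; apply: snat_inj => M; apply: dval_inj; apply/lfunP => v.
by rewrite dval_act_family (in_snat_act_eval _ (snatP e)).
Qed.

Lemma act_snatK : cancel (@act_snat k A) eval_snat.
Proof.
move=> z; apply: dval_inj; rewrite /= /eval_one dval_act_family.
exact: smulx1.
Qed.
End Evaluation.

Theorem proposition46 (k : closedFieldType) (char_k : 2%N \notin [pchar k])
    (A : finSuperAlgType k) :
  superAlgIso (snatEnd (idSuperFunctor (smodCategory A))) (largeSuperAlg_of (superCenter A)).
Proof.
exists (@eval_snat k A); split.
- split; first exact: Bijective (@eval_snatK k A) (@act_snatK k A).
  by apply: dval_inj; rewrite /= /eval_one /= id_lfunE.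
- move=> x y; apply: dval_inj; apply: etrans (esym (dvalD _ _)).
  by rewrite /= /eval_one /= /family_add add_lfunE.
- move=> c x; apply: dval_inj; apply: etrans (esym (dvalZ _ _)).
  by rewrite /= /eval_one /= /family_scale scale_lfunE.
- move=> x y; apply: dval_inj.
  (* The component of x at the regular module is left multiplication by [eval_one x], here applied
     to [eval_one y]; the order of the product is thus preserved. *)
  rewrite /= {1}/eval_one /= comp_lfunE.
  exact: (@in_snat_act_eval _ _ _ (regular_smod A) _ (snatP x)).
by move=> i x hx; exact: eval_one_supercentral.
Qed.
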